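(* Let $P$ be a finite poset and $Q$ a subposet of $P$. Then $P\searrow^{wd}Q$ if and only if $\mathrm{Comp}(P)\searrow^{d}\mathrm{Comp}(Q)$.
   Context: Posets are finite; a subposet carries the induced order. $P_{>p}=\{y\in P: y>p\}$ and $P_{<p}=\{y\in P:y<p\}$. A poset is a double cone with apex $a$ if $a$ is an element of it comparable with all its elements. An element $p\in P$ is weakly dominated by $a$ if $P_{>p}\cup P_{<p}$ is a double cone with apex $a$ (in particular $a\in P_{>p}\cup P_{<p}$); $p$ is weakly dismantlable if it is weakly dominated by some $a$. $P\searrow^{wd}Q$ means that one can go from $P$ to the subposet $Q$ by successively deleting (finitely many, possibly zero) elements, each weakly dismantlable in the poset from which it is deleted. The comparability graph $\mathrm{Comp}(P)$ is the reflexive graph with vertex set $P$ and $x\sim y$ iff $x$ and $y$ are comparable in $P$ (so each vertex is looped). For a graph $G$ (finite, undirected, no parallel edges, loops allowed), $N_G(x)=\{y: y\sim x\}$; a vertex $x$ is dismantlable if there is a vertex $a\neq x$ with $N_G(x)\subset N_G(a)$. $G\searrow^{d}H$, for a subgraph $H$ of $G$, means: $H$ is the subgraph of $G$ induced by $V(H)$ and one can write $V(G)\setminus V(H)=\{x_1,\dots,x_k\}$ ($k\ge0$, distinct) so that each $x_i$ is dismantlable in the subgraph of $G$ induced by $V(H)\cup\{x_i,\dots,x_k\}$. *)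

(* Defs.v *)
From HB Require Import structures.
From mathcomp Require Import all_boot all_order.

Set Implicit Arguments.
Unset Strict Implicit.
Unset Printing Implicit Defensive.

Import Order.TTheory.

Local Open Scope order_scope.

(* A subposet of [P] is given by its carrier [S : {set P}], with the order     *)
(* induced from [P]; [P] itself is the carrier [set: P].                       *)
Section Posets.

Context {d : Order.disp_t} {P : finPOrderType d}.
Implicit Types (S : {set P}) (p a : P).

Definition above S p : {set P} := [set y in S | p < y].

Definition below S p : {set P} := [set y in S | y < p].

Definition double_cone S a : bool :=
  (a \in S) && [forall y in S, y >=< a].

Definition weakly_dominated S p a : bool :=
  (p \in S) && double_cone (above S p :|: below S p) a.

Definition weakly_dismantlable S p : bool :=
  [exists a, weakly_dominated S p a].

Inductive wd_reduces : {set P} -> {set P} -> Prop :=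
| wd_refl S : wd_reduces S S
| wd_step S p S' :
    weakly_dismantlable S p -> wd_reduces (S :\ p) S' -> wd_reduces S S'.

End Posets.

(* Graphs whose vertices are taken in an ambient finite type [T], so that a    *)
(* graph and its subgraphs live in the same type.  Loops are allowed.          *)
Record graph (T : finType) := Graph {
  vertices : {set T};
  adj : rel T;
  adj_sym : symmetric adj;
  adj_vertices : forall x y, adj x y -> x \in vertices
}.

Section Graphs.

Variable T : finType.
Implicit Types (G H : graph T) (S : {set T}) (x a : T).

Definition neighbours G x : {set T} := [set y | adj G y x].

Definition dismantlable G x : bool :=
  (x \in vertices G) &&
  [exists a in vertices G, (a != x) && (neighbours G x \subset neighbours G a)].

Section Induced.

Variables (G : graph T) (S : {set T}).

Definition induced_adj : rel T :=
  [rel x y | [&& x \in S, y \in S & adj G x y]].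

Fact induced_adj_sym : symmetric induced_adj.
Proof. by move=> x y; rewrite /induced_adj /= adj_sym andbCA. Qed.

Fact induced_adj_vertices x y : induced_adj x y -> x \in vertices G :&: S.
Proof. by case/and3P=> Sx _ /adj_vertices Gx; rewrite inE Gx. Qed.

Definition induced : graph T := Graph induced_adj_sym induced_adj_vertices.

End Induced.

Definition induced_subgraph H G : Prop :=
  vertices H \subset vertices G /\ {in vertices H &, adj H =2 adj G}.

(* The sequence [s] lists the vertices in their order of deletion.             *)
Definition d_reduces G H : Prop :=
  induced_subgraph H G /\
  exists s : seq T,
    [/\ uniq s,
        s =i vertices G :\: vertices H
      & forall s1 x s2, s = s1 ++ x :: s2 ->
          dismantlable (induced G (vertices H :|: [set y in x :: s2])) x].

End Graphs.

Section Comparability.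

Context {d : Order.disp_t} {P : finPOrderType d}.
Variable S : {set P}.

Definition comp_adj : rel P := [rel x y | [&& x \in S, y \in S & x >=< y]].

Fact comp_adj_sym : symmetric comp_adj.
Proof. by move=> x y; rewrite /comp_adj /= comparable_sym andbCA. Qed.

Fact comp_adj_vertices x y : comp_adj x y -> x \in S.
Proof. by case/and3P. Qed.

Definition Comp : graph P := Graph comp_adj_sym comp_adj_vertices.

End Comparability.

(* Main.v *)
Require Import Defs.
From HB Require Import structures.
From mathcomp Require Import all_boot all_order.

Set Implicit Arguments.
Unset Strict Implicit.
Unset Printing Implicit Defensive.

(** The two kinds of reduction agree one deletion at a time.  Because every
    vertex of a comparability graph is looped, the neighbourhood of [p] in the
    graph of a subposet [S] is [p] together with everything of [S] strictly
    above or below [p].  An inclusion of this neighbourhood in that of some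
    [a != p] says two things: [p] itself is adjacent to [a], so that [a] lies
    strictly above or below [p]; and every other element comparable with [p] is
    comparable with [a].  This is exactly weak domination of [p] by [a]
    ([dismantlable_Comp]).

    What remains is bookkeeping: the inductive relation [wd_reduces] is turned
    into the existence of a list of deletions, in which the poset left before
    [x] is deleted consists of the final poset, [x], and the elements that
    come after [x] ([wd_reducesP]). *)

Section WeakDismantling.

Context {d : Order.disp_t} {P : finPOrderType d}.
Implicit Types (S Q : {set P}) (p a x y : P) (s : seq P).

Lemma in_above_below S p y :
  (y \in above S p :|: below S p)
  = [&& y \in S, y != p & (y >=< p)%O].
Proof.
rewrite !inE -andb_orr; congr (_ && _).
by case: (Order.POrderTheory.comparableP y p).
Qed.

Lemma in_neighbours_Comp S p y :
  (y \in neighbours (induced (Comp [set: P]) S) p)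
  = [&& y \in S, p \in S & (y >=< p)%O].
Proof. by rewrite inE /= /induced_adj /= /comp_adj /= !in_setT. Qed.

(** Adjacency of [p] to [a], which weak domination requires, is recovered from
    the inclusion of neighbourhoods by applying it to the loop at [p]. *)
Lemma dismantlable_Comp S p :
  dismantlable (induced (Comp [set: P]) S) p = weakly_dismantlable S p.
Proof.
apply/andP/existsP => [[]|[a /and3P[pS]]].
  rewrite !inE /= => pS /exists_inP[a]; rewrite !inE /= => aS.
  case/andP=> a_neq_p /subsetP Npa; exists a.
  have pa : (p >=< a)%O.
    have := Npa p; rewrite !in_neighbours_Comp pS aS /=.
    by apply; apply: Order.POrderTheory.comparablexx.
  rewrite /weakly_dominated pS /double_cone in_above_below aS a_neq_p.
  rewrite Order.POrderTheory.comparable_sym pa /=.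
  apply/forall_inP => y; rewrite in_above_below => /and3P[yS _ yp].
  by have := Npa y; rewrite !in_neighbours_Comp yS pS aS; apply.
rewrite in_above_below => /and3P[aS a_neq_p ap] /forall_inP cone_a.
split; first by rewrite !inE.
apply/exists_inP; exists a; first by rewrite !inE.
rewrite a_neq_p; apply/subsetP => y; rewrite !in_neighbours_Comp pS aS /=.
case/andP=> yS yp; rewrite yS /=.
have [->|y_neq_p] := eqVneq y p.
  by rewrite Order.POrderTheory.comparable_sym.
by apply: cone_a; rewrite in_above_below yS y_neq_p.
Qed.

Lemma wd_reduces_sub S Q : wd_reduces S Q -> Q \subset S.
Proof.
by elim=> // {Q}S p Q _ _ /subset_trans; apply; apply: subD1set.
Qed.

(** Recording each intermediate poset as [Q] together with the elements still to
    be deleted makes a reduction of posets directly comparable with a reduction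
    of graphs, where the intermediate graphs are given in this way. *)
Lemma wd_reducesP S Q :
  wd_reduces S Q <->
  Q \subset S /\
  exists s, [/\ uniq s, s =i S :\: Q
    & forall s1 x s2, s = s1 ++ x :: s2 ->
        weakly_dismantlable (Q :|: [set y in x :: s2]) x].
Proof.
split=> [red_SQ|[sub_QS [s [uniq_s s_eq wd_s]]]].
  split; first exact: wd_reduces_sub.
  elim: red_SQ => [{Q}S|{Q}S p Q wd_p red_Q [s [uniq_s s_eq wd_s]]].
    exists [::]; split=> // [y|[]//].
    by rewrite setDv inE.
  have pS : p \in S by case/existsP: wd_p => a /andP[].
  have /subsetD1P[sub_QS pQ] := wd_reduces_sub red_Q.
  exists (p :: s); split=> [|y|].
  - by rewrite /= uniq_s s_eq !inE eqxx andbF.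
  - rewrite inE s_eq !inE.
    by have [->|] := eqVneq y p; rewrite ?pS ?pQ.
  - case=> [|q s1] x s2 /=; last by case=> _ /wd_s.
    case=> <- <-; suff -> : Q :|: [set y in p :: s] = S by [].
    apply/setP => y; rewrite !inE s_eq !inE.
    have [->|_] := eqVneq y p; first by rewrite pS orbT.
    by have [/(subsetP sub_QS)->|] := boolP (y \in Q).
elim: s S sub_QS uniq_s s_eq wd_s => [|p s IHs] S sub_QS.
  move=> _ s_eq _; suff -> : S = Q by apply: wd_refl.
  apply/eqP; rewrite eqEsubset sub_QS andbT -setD_eq0.
  by apply/eqP/setP => y; rewrite -s_eq inE.
case/andP=> ps uniq_s s_eq wd_s.
have /setDP[pS pQ] : p \in S :\: Q by rewrite -s_eq mem_head.
have defS : Q :|: [set y in p :: s] = S.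
  apply/setP => y; rewrite in_setU in_set s_eq in_setD.
  by have [/(subsetP sub_QS)->|] := boolP (y \in Q).
apply: (@wd_step _ _ _ p); first by rewrite -defS; apply: (wd_s [::]).
apply: IHs => //; first by rewrite subsetD1 sub_QS.
  move=> y; have := s_eq y; rewrite !inE.
  have [->|_] := eqVneq y p; last by [].
  by rewrite andbF (negPf ps).
by move=> s1 x s2 s_split; apply: (wd_s (p :: s1)); rewrite s_split.
Qed.

Lemma induced_subgraph_Comp Q : induced_subgraph (Comp Q) (Comp [set: P]).
Proof.
split; first exact: subsetT.
by move=> x y /= xQ yQ; rewrite /comp_adj /= xQ yQ !in_setT.
Qed.

End WeakDismantling.

Theorem theorem3p1 (d : Order.disp_t) (P : finPOrderType d) (Q : {set P}) :
  wd_reduces [set: P] Q <-> d_reduces (Comp [set: P]) (Comp Q).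
Proof.
split=> [/wd_reducesP|] [_ [s [uniq_s s_eq wd_s]]].
  split; first exact: induced_subgraph_Comp.
  exists s; split=> // s1 x s2 /wd_s.
  by rewrite dismantlable_Comp.
apply/wd_reducesP; split; first exact: subsetT.
exists s; split=> // s1 x s2 /wd_s.
by rewrite dismantlable_Comp.
Qed.
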